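(* Let $R$ be a one-dimensional complete Noetherian local domain of prime characteristic $p>0$ with algebraically closed residue field. Then for every ideal $I$ of $R$, $\overline{I}=I^\star=I^F$.
   Context: $\overline{I}$ is the integral closure of $I$, $I^\star$ is the tight closure of $I$, and $I^F=\{x\in R: x^{q}\in I^{[q]}\text{ for some } q=p^e\}$ is the Frobenius closure of $I$, where $I^{[q]}$ is generated by the $q$-th powers of elements of $I$. *)

(* Defs.v *)
From HB Require Import structures.
From mathcomp Require Import all_boot all_order all_algebra.
From mathcomp Require Import boolp classical_sets.

Set Implicit Arguments.
Unset Strict Implicit.
Unset Printing Implicit Defensive.

Import GRing.Theory.
Local Open Scope classical_set_scope.
Local Open Scope ring_scope.

(* Arbitrary ideals are classical sets and may be the whole ring.  Proper and
   prime ideals are the [idealr R] and [prime_idealr R] of ring_quotient, which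
   exclude 1; they are boolean predicates, which is no restriction in the
   presence of the classical axioms of boolp. *)
Definition is_ideal (R : comNzRingType) (I : set R) : Prop :=
  [/\ I 0, (forall x y, I x -> I y -> I (x + y)) &
      (forall a x, I x -> I (a * x))].

Definition ideal_gen (R : comNzRingType) (S : set R) : set R :=
  smallest (@is_ideal R) S.

Definition ideal_mul (R : comNzRingType) (I J : set R) : set R :=
  ideal_gen [set x * y | x in I & y in J].

Definition ideal_exp (R : comNzRingType) (I : set R) (n : nat) : set R :=
  iter n (ideal_mul I) [set: R].

Definition noetherian (R : comNzRingType) : Prop :=
  forall I : set R, is_ideal I -> exists s : seq R, I = ideal_gen [set` s].

Definition maximal_ideal (R : comNzRingType) (m : idealr R) : Prop :=
  forall J : idealr R, {subset m <= J} -> {subset J <= m}.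

Definition local_with (R : comNzRingType) (m : idealr R) : Prop :=
  maximal_ideal m /\ (forall J : idealr R, maximal_ideal J -> J =i m).

Definition prime_chain (R : comNzRingType) (n : nat)
    (P : 'I_n.+1 -> prime_idealr R) : Prop :=
  forall i j : 'I_n.+1, (i < j)%N ->
    {subset P i <= P j} /\ ~ {subset P j <= P i}.

Definition krull_dim_is (R : comNzRingType) (d : nat) : Prop :=
  (exists P : 'I_d.+1 -> prime_idealr R, prime_chain P) /\
  (forall n (P : 'I_n.+1 -> prime_idealr R), prime_chain P -> (n <= d)%N).

(* Complete includes separated: R is the inverse limit of the R / I ^ k. *)
Definition adically_complete (R : comNzRingType) (I : set R) : Prop :=
  (forall x : R, (forall k, ideal_exp I k x) -> x = 0) /\
  (forall u : nat -> R,
     (forall k, exists N, forall i j, (N <= i)%N -> (N <= j)%N ->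
        ideal_exp I k (u i - u j)) ->
     exists l : R, forall k, exists N, forall i, (N <= i)%N ->
        ideal_exp I k (u i - l)).

Definition integral_closure (R : comNzRingType) (I : set R) : set R :=
  [set x | exists (n : nat) (a : nat -> R),
     [/\ (0 < n)%N,
         (forall i, (1 <= i <= n)%N -> ideal_exp I i (a i)) &
         x ^+ n + \sum_(1 <= i < n.+1) a i * x ^+ (n - i) = 0]].

Definition minimal_prime (R : comNzRingType) (P : prime_idealr R) : Prop :=
  forall Q : prime_idealr R, {subset Q <= P} -> {subset P <= Q}.

(* The usual R° : the complement of the union of the minimal primes. *)
Definition off_minimal_primes (R : comNzRingType) : set R :=
  [set c | forall P : prime_idealr R, minimal_prime P -> c \notin P].

Definition frobenius_power (R : comNzRingType) (I : set R) (q : nat) : set R :=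
  ideal_gen [set x ^+ q | x in I].

Definition tight_closure (R : comNzRingType) (p : nat) (I : set R) : set R :=
  [set x | exists2 c, off_minimal_primes c &
     exists e0 : nat, forall e, (e0 <= e)%N ->
       frobenius_power I (p ^ e)%N (c * x ^+ (p ^ e)%N)].

Definition frobenius_closure (R : comNzRingType) (p : nat) (I : set R) :
    set R :=
  [set x | exists e : nat, frobenius_power I (p ^ e)%N (x ^+ (p ^ e)%N)].

(* Main.v *)
Require Import Defs.
From HB Require Import structures.
From mathcomp Require Import all_boot all_order all_algebra.
From mathcomp Require Import boolp classical_sets.
From mathcomp Require Import ring.

(** Write q for powers of p.  Everything rests on one comparison: for all x, y
    in R there is a q such that x^q divides y^q or y^q divides x^q
    ([frob_comparable]).  Geometrically, the integral closure S of R is a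
    discrete valuation ring, and since R is complete with perfect residue field
    equal to that of S, s^q lies in R for each s in S and q large: s differs
    from some a in R by a nonunit of S, whose high powers lie in the conductor,
    and s^q - a^q = (s - a)^q.

    Given the comparison, an ideal I with finitely many generators contains an
    x such that y^q is a multiple of x^q for all y in I and one fixed q
    ([frob_principal]); hence I^[q] = x^q R for all large q, and y lies in the
    Frobenius closure iff y^q is in x^q R for some q.  Integral closure and
    tight closure are reduced to this condition by the comparison of x and y:
    if x^q = r y^q with r in m, then an integral equation of y over I becomes
    y^N (1 + element of m) = 0, while a tight closure multiplier c is divisible
    by arbitrarily high powers of r, hence is 0 because R is separated.

    The comparison is proved without constructing S.  For x nonzero in m, put
    f = y/x.  Since R has dimension one, the Krull-Akizuki argument yields a
    polynomial relation of f over R whose coefficients are not all in m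
    ([exists_primitive_relation]).  Some a in R is not a root of it modulo m,
    because the residue field is algebraically closed, so u = 1/(f - a)
    satisfies a monic equation ([inverse_integral]).  Then u^q lies in R for
    some q ([integral_frob]), and u^q = x^q / (y^q - a^q x^q) compares x^q with
    y^q.

    For integral u, let P be monic of least degree such that P(u) is
    topologically nilpotent.  If P were not linear, then P modulo m would split
    off a root, and either a repeated root would allow a smaller P or a
    coprime factorization would yield an approximate idempotent e in R[u].
    The powers e^q converge to an idempotent of the fraction field, which is 0
    or 1, so that one of the factors was topologically nilpotent already
    ([top_nil_idempotent]). *)

Set Implicit Arguments.
Unset Strict Implicit.
Unset Printing Implicit Defensive.

Import GRing.Theory.
Local Open Scope classical_set_scope.
Local Open Scope ring_scope.

Local Notation "x %:F" := (tofrac x).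

(** * Ideals and their powers *)

Section Ideals.
Variable R : comNzRingType.
Implicit Types (I J K : set R) (x y : R).

Lemma is_ideal_gen (S : set R) : is_ideal (ideal_gen S).
Proof.
split.
- by move=> A [[]].
- by move=> x y Sx Sy A [iA SA]; case: (iA) => _ DA _; apply: DA; [exact: Sx|exact: Sy].
- by move=> a x Sx A [iA SA]; case: (iA) => _ _ MA; apply: MA; exact: Sx.
Qed.

Lemma sub_ideal_gen (S : set R) : S `<=` ideal_gen S.
Proof. by move=> x Sx A [_ SA]; exact: SA. Qed.

Lemma ideal_gen_min (S : set R) J : is_ideal J -> S `<=` J -> ideal_gen S `<=` J.
Proof. by move=> iJ SJ x; apply. Qed.

Lemma idealB I x y : is_ideal I -> I x -> I y -> I (x - y).
Proof. by case=> _ ID IM Ix Iy; apply: ID => //; rewrite -mulN1r; apply: IM. Qed.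

Lemma is_ideal_exp I n : is_ideal (ideal_exp I n).
Proof. by case: n => [|n]; [split|exact: is_ideal_gen]. Qed.

Lemma ideal_expS I n x y : I x -> ideal_exp I n y -> ideal_exp I n.+1 (x * y).
Proof. by move=> Ix Iy; apply: sub_ideal_gen; exists x => //; exists y. Qed.

(** Induction principle for membership in powers of an ideal, which spares an
    explicit description by sums of products. *)
Lemma ideal_expS_min I J n : is_ideal J ->
  (forall x y, I x -> ideal_exp I n y -> J (x * y)) -> ideal_exp I n.+1 `<=` J.
Proof. by move=> iJ IJ; apply: ideal_gen_min => // _ [x Ix [y Iy <-]]; exact: IJ. Qed.

Lemma is_ideal_colon J x : is_ideal J -> is_ideal [set y | J (x * y)].
Proof.
case=> J0 JD JM; split=> /=; first by rewrite mulr0.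
- by move=> y z Jy Jz; rewrite mulrDr; apply: JD.
- by move=> a y Jy; rewrite mulrCA; apply: JM.
Qed.

Lemma ideal_exp_mul I i j x y :
  ideal_exp I i x -> ideal_exp I j y -> ideal_exp I (i + j) (x * y).
Proof.
elim: i x => [|i IHi] x Ix Iy.
  by case: (is_ideal_exp I j) => _ _; apply.
rewrite mulrC; move: x Ix; apply: ideal_expS_min.
  exact/is_ideal_colon/is_ideal_exp.
move=> a b Ia Ib /=; rewrite mulrCA; apply: ideal_expS => //.
by rewrite mulrC; apply: IHi.
Qed.

(** The products of the two smaller powers generate the larger one, so such
    products are all that must be tested for an inclusion. *)
Lemma ideal_expD_min I J i j : is_ideal J ->
  (forall x y, ideal_exp I i x -> ideal_exp I j y -> J (x * y)) ->
  ideal_exp I (i + j) `<=` J.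
Proof.
elim: i J => [|i IHi] J iJ IJ.
  by move=> y Iy; rewrite -[y]mul1r; apply: IJ.
apply: ideal_expS_min => // a w Ia; move: w.
apply: (IHi [set w | J (a * w)]); first exact: is_ideal_colon.
by move=> x y Ix Iy /=; rewrite mulrA; apply: IJ => //; apply: ideal_expS.
Qed.

Lemma ideal_exp_le I i j : (i <= j)%N -> ideal_exp I j `<=` ideal_exp I i.
Proof.
move=> /subnKC <-; elim: (j - i)%N => [|k IHk]; first by rewrite addn0.
rewrite addnS => x Ix; apply: IHk; move: x Ix; apply: ideal_expS_min.
  exact: is_ideal_exp.
by move=> x y _ Iy; case: (is_ideal_exp I (i + k)) => _ _; apply.
Qed.

Lemma ideal_exp1 I x : I x -> ideal_exp I 1 x.
Proof. by move=> Ix; rewrite -[x]mulr1; apply: ideal_expS. Qed.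

Lemma ideal_exp1_sub I : is_ideal I -> ideal_exp I 1 `<=` I.
Proof.
move=> iI; apply: ideal_expS_min => // x y Ix _.
by rewrite mulrC; case: iI => _ _; apply.
Qed.

Lemma ideal_exp_exprn I i n x : ideal_exp I i x -> ideal_exp I (i * n) (x ^+ n).
Proof.
move=> Ix; elim: n => [|n IHn]; first by rewrite muln0.
by rewrite mulnS exprS; apply: ideal_exp_mul.
Qed.

Lemma ideal_exprn I n x : I x -> ideal_exp I n (x ^+ n).
Proof. by move=> /ideal_exp1 /(@ideal_exp_exprn _ _ n); rewrite mul1n. Qed.

Definition principal x : set R := [set y | exists a, y = a * x].

Lemma is_ideal_principal x : is_ideal (principal x).
Proof.
split; first by exists 0; rewrite mul0r.
- by move=> _ _ [a ->] [b ->]; exists (a + b); rewrite mulrDl.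
- by move=> a _ [b ->]; exists (a * b); rewrite mulrA.
Qed.

Definition ideal_add J x : set R := [set y | exists2 z, J z & exists a, y = z + a * x].

Lemma is_ideal_add J x : is_ideal J -> is_ideal (ideal_add J x).
Proof.
case=> J0 JD JM; split; first by exists 0 => //; exists 0; rewrite mul0r addr0.
- move=> _ _ [y Jy [a ->]] [z Jz [b ->]]; exists (y + z); first exact: JD.
  by exists (a + b); rewrite mulrDl addrACA.
- move=> a _ [z Jz [b ->]]; exists (a * z); first exact: JM.
  by exists (a * b); rewrite mulrDr mulrA.
Qed.

Lemma sub_ideal_add J x : J `<=` ideal_add J x.
Proof. by move=> y Jy; exists y => //; exists 0; rewrite mul0r addr0. Qed.

Lemma ideal_add_mem J x : is_ideal J -> ideal_add J x x.
Proof. by case=> J0 _ _; exists 0 => //; exists 1; rewrite mul1r add0r. Qed.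

Lemma idealr_of_set J : is_ideal J -> ~ J 1 ->
  exists K : idealr R, forall x, J x <-> x \in K.
Proof.
move=> iJ J1; have [J0 JD JM] := iJ.
pose S : R -> bool := fun x => `[<J x>].
have SJ x : reflect (J x) (x \in S) by exact: asboolP.
have Sc : idealr_closed S.
  split; [exact/SJ|by apply/negP => /SJ|].
  by move=> a x y /SJ Jx /SJ Jy; apply/SJ; apply: JD => //; apply: JM.
pose b := isIdealr.Build R S Sc.
pose K : idealr R := HB.pack S b.
by exists K => x; apply: rwP (SJ x).
Qed.

Lemma prime_idealr_of_set J : is_ideal J -> ~ J 1 ->
  (forall x y, J (x * y) -> J x \/ J y) ->
  exists K : prime_idealr R, forall x, J x <-> x \in K.
Proof.
move=> iJ J1 Jp; have [J0 JD JM] := iJ.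
pose S : R -> bool := fun x => `[<J x>].
have SJ x : reflect (J x) (x \in S) by exact: asboolP.
have Sc : idealr_closed S.
  split; [exact/SJ|by apply/negP => /SJ|].
  by move=> a x y /SJ Jx /SJ Jy; apply/SJ; apply: JD => //; apply: JM.
have Sp : prime_idealr_closed S.
  by move=> x y /SJ/Jp [] /SJ ->; rewrite ?orbT.
pose b := isIdealr.Build R S Sc.
pose K : prime_idealr R := HB.pack S b (isPrimeIdealrClosed.Build R S Sp).
by exists K => x; apply: rwP (SJ x).
Qed.

Lemma is_ideal_idealr (K : idealr R) : is_ideal [set` K].
Proof.
split=> /=; first exact: idealr0.
- by move=> x y; apply: rpredD.
- by move=> a x; apply: idealMr.
Qed.

End Ideals.

(** * Noetherian rings *)

Section Noetherian.
Variable R : comNzRingType.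
Hypothesis noethR : noetherian R.

Lemma noetherian_chain (u : nat -> set R) :
  (forall n, is_ideal (u n)) -> (forall n, u n `<=` u n.+1) ->
  exists n, forall k, u k `<=` u n.
Proof.
move=> iu uS.
have uM i j : (i <= j)%N -> u i `<=` u j.
  move=> /subnKC <-; elim: (j - i)%N => [|k IHk]; first by rewrite addn0.
  by rewrite addnS => x /IHk /uS.
pose U : set R := [set x | exists n, u n x].
have iU : is_ideal U.
  split; first by exists 0%N; case: (iu 0%N).
  - move=> x y [i ux] [j uy]; exists (maxn i j); case: (iu (maxn i j)) => _ D _.
    by apply: D; [move: ux|move: uy]; apply: uM; rewrite ?leq_maxl ?leq_maxr.
  - by move=> a x [i ux]; exists i; case: (iu i) => _ _; apply.
have [s Us] := noethR iU.
have [n sn] : exists n, forall x, x \in s -> u n x.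
  have: forall x, x \in s -> U x by move=> x xs; rewrite Us; exact: sub_ideal_gen.
  elim: (s) => [|y s' IHs] sU; first by exists 0%N.
  have [i ui] := IHs (fun x xs => sU x (@mem_behead _ (y :: s') _ xs)).
  have [j uj] := sU y (mem_head _ _).
  exists (maxn i j) => x; rewrite inE => /predU1P[->|/ui ux].
  - by move: uj; apply: uM; exact: leq_maxr.
  - by move: ux; apply: uM; exact: leq_maxl.
exists n => k x ukx.
have: U x by exists k.
by rewrite Us; move: x {ukx}; apply: ideal_gen_min => // x /sn.
Qed.

(** The ascending chain condition, in the form of the existence of maximal
    elements in a nonempty family of ideals. *)
Lemma noetherian_max (Phi : set R -> Prop) (I0 : set R) :
  (forall J, Phi J -> is_ideal J) -> Phi I0 ->
  exists2 J, Phi J & forall K, Phi K -> J `<=` K -> K `<=` J.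
Proof.
move=> iPhi Phi0; apply: contrapT => nex.
have next (J : {J | Phi J}) :
    exists K : {K | Phi K}, sval J `<=` sval K /\ ~ sval K `<=` sval J.
  apply: contrapT => nK; apply: nex; exists (sval J); first exact: svalP.
  move=> K PK JK; apply: contrapT => nKJ; apply: nK; by exists (exist _ K PK).
have [f fP] := choice next.
pose u n := iter n f (exist _ I0 Phi0).
have [|n|n un] := @noetherian_chain (fun n => sval (u n)).
- by move=> n; apply: iPhi; exact: svalP.
- by case: (fP (u n)).
- by case: (fP (u n)) => _; apply; exact: (un n.+1).
Qed.

(** The ascending chain (t 0), (t 0, t 1), ... is stationary. *)
Lemma noetherian_dependence (t : nat -> R) :
  exists d (c : nat -> R), t d = \sum_(i < d) c i * t i.
Proof.
pose u d : set R := [set x | exists c : nat -> R, x = \sum_(i < d) c i * t i].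
have iu d : is_ideal (u d).
  split; first by exists (fun=> 0); rewrite big1 // => i _; rewrite mul0r.
  - move=> _ _ [a ->] [b ->]; exists (fun i => a i + b i).
    by rewrite -big_split; apply: eq_bigr => i _; rewrite mulrDl.
  - move=> a _ [b ->]; exists (fun i => a * b i).
    by rewrite mulr_sumr; apply: eq_bigr => i _; rewrite mulrA.
have uS d : u d `<=` u d.+1.
  move=> _ [c ->]; exists (fun i => if (i < d)%N then c i else 0).
  rewrite big_ord_recr /= ltnn mul0r addr0.
  by apply: eq_bigr => i _; rewrite ltn_ord.
have [n un] := noetherian_chain iu uS.
have /un [c tc] : u n.+1 (t n).
  exists (fun i => (i == n)%:R); rewrite big_ord_recr /= eqxx mul1r big1 ?add0r //.
  by move=> i _; rewrite ltn_eqF ?mul0r.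
by exists n, c.
Qed.

End Noetherian.

(** * Local domains of dimension one *)

Lemma exists_zero_prime (R : idomainType) :
  exists P : prime_idealr R, forall x, x = 0 <-> x \in P.
Proof.
apply: (@prime_idealr_of_set R [set 0]).
- by split=> //= [x y -> ->|a x ->]; [exact: addr0|exact: mulr0].
- by move=> /= /eqP; rewrite oner_eq0.
- by move=> x y /eqP; rewrite mulf_eq0 => /orP[]/eqP; [left|right].
Qed.

Section LocalDomain.
Variables (R : idomainType) (m : idealr R).
Hypotheses (noethR : noetherian R) (localR : local_with m).

Lemma local_unit x : (x \is a GRing.unit) = (x \notin m).
Proof.
apply/idP/idP => [Ux|/negP nmx].
  apply/negP => mx; have := idealr1 m.
  by rewrite -(mulVr Ux) idealMr.
apply: contrapT => nUx; apply: nmx.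
pose Phi J := [/\ is_ideal J, ~ J 1 & J x].
have PhiP : Phi (principal x).
  split; [exact: is_ideal_principal| |by exists 1; rewrite mul1r].
  case=> a ax; apply: nUx; apply/unitrP; exists a.
  by rewrite [x * a]mulrC.
have [J [iJ J1 Jx] Jmax] := noetherian_max noethR (Phi := Phi) (fun J '(And3 iJ _ _) => iJ) PhiP.
have [K KJ] := idealr_of_set iJ J1.
rewrite -(localR.2 K) ?(KJ x).1 // => L KL y Ly.
apply/KJ; apply: (Jmax [set` L]) => //.
- split=> /=; [exact: is_ideal_idealr|by rewrite idealr1|exact/KL/KJ].
- by move=> z /KJ /KL.
Qed.

Lemma maximal_ideal_prime : forall x y, x * y \in m -> x \in m \/ y \in m.
Proof.
move=> x y; have [|nx] := boolP (x \in m); [by left|move=> mxy; right].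
by rewrite -local_unit in nx; rewrite -(mulKr nx y) idealMr.
Qed.

Hypothesis dimR : krull_dim_is R 1.

(** This is where the Krull dimension enters: an ideal maximal among those that
    contain c but no power of m is prime, and would lie strictly between 0
    and m. *)
Lemma ideal_exp_sub_nonzero J c : is_ideal J -> J c -> c != 0 ->
  exists n, ideal_exp [set` m] n `<=` J.
Proof.
move=> iJ0 J0c c0; apply: contrapT => nJ0.
pose Phi K := [/\ is_ideal K, K c & ~ exists n, ideal_exp [set` m] n `<=` K].
have [K [iK Kc nK] Kmax] :=
  noetherian_max noethR (Phi := Phi) (fun K '(And3 iK _ _) => iK) (And3 iJ0 J0c nJ0).
have [_ KD KM] := iK.
have K1 : ~ K 1.
  by move=> K1; apply: nK; exists 0%N => x _; rewrite -[x]mulr1; apply: KM.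
have up x : ~ K x -> exists n, ideal_exp [set` m] n `<=` ideal_add K x.
  move=> nKx; apply: contrapT => nn; apply: nKx.
  apply: (Kmax (ideal_add K x)); last exact: ideal_add_mem.
  - by split=> //; [exact: is_ideal_add|exact: sub_ideal_add].
  - exact: sub_ideal_add.
have Kp x y : K (x * y) -> K x \/ K y.
  move=> Kxy; apply: contrapT => /not_orP[/up[i xi] /up[j yj]].
  apply: nK; exists (i + j)%N; apply: ideal_expD_min => //.
  move=> _ _ /xi[a Ka [b ->]] /yj[a' Ka' [b' ->]].
  have -> : (a + b * x) * (a' + b' * y) =
    (a' + b' * y) * a + (b * x * a' + b * b' * (x * y)) by ring.
  by apply: (KD); [apply: KM|apply: (KD); apply: KM].
have [P2 P2P] := prime_idealr_of_set (is_ideal_idealr m)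
  (fun m1 : m 1 => negP (negbT (idealr1 m)) m1) maximal_ideal_prime.
have [P1 P1P] := prime_idealr_of_set iK K1 Kp.
have [P0 P0P] := exists_zero_prime R.
pose P (i : 'I_3) := nth P0 [:: P0; P1; P2] i.
have s01 : {subset P0 <= P1} by move=> x /P0P ->; apply/P1P; case: iK.
have s12 : {subset P1 <= P2}.
  move=> x /P1P Kx; apply/P2P => /=; apply: contraT; rewrite -local_unit => Ux.
  by case: K1; rewrite -(mulVr Ux); apply: KM.
have n01 : ~ {subset P1 <= P0}.
  by move=> /(_ c ((P1P c).1 Kc)) /P0P /eqP; rewrite (negPf c0).
have n12 : ~ {subset P2 <= P1}.
  move=> s21; apply: nK; exists 1%N => x /ideal_exp1_sub - /(_ (is_ideal_idealr m)) mx.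
  by apply/P1P/s21/P2P.
have chainP : prime_chain P.
  case=> [[|[|[|//]]] hi] [[|[|[|//]]] hj] //= _; rewrite /P /=; split=> //.
  - by move=> x /s01 /s12.
  - by move=> s20; apply: n12 => x /s20 /s01.
by have := dimR.2 _ _ chainP.
Qed.

End LocalDomain.

(** * Evaluating polynomials at a fraction *)

Section FracEval.
Variable R : idomainType.

Definition frac_eval (f : {fraction R}) : {poly R} -> {fraction R} :=
  horner_morph (fun a : R => mulrC f a%:F).

HB.instance Definition _ f := GRing.RMorphism.on (frac_eval f).

Lemma frac_evalC f a : frac_eval f a%:P = a%:F.
Proof. exact: horner_morphC. Qed.

Lemma frac_evalX f : frac_eval f 'X = f.
Proof. exact: horner_morphX. Qed.

Lemma frac_eval_sum f n (E : nat -> R) :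
  frac_eval f (\poly_(i < n) E i) = \sum_(i < n) (E i)%:F * f ^+ i.
Proof.
rewrite poly_def rmorph_sum; apply: eq_bigr => i _.
by rewrite -mul_polyC rmorphM rmorphXn /= frac_evalC frac_evalX.
Qed.

Lemma frac_evalE f h : frac_eval f h = \sum_(i < size h) (h`_i)%:F * f ^+ i.
Proof. by rewrite -frac_eval_sum coefK. Qed.

Lemma frac_eval_comp (f : {fraction R}) G h :
  frac_eval f (G \Po h) = frac_eval (frac_eval f h) G.
Proof.
rewrite comp_polyE rmorph_sum frac_evalE; apply: eq_bigr => i _.
by rewrite -mul_polyC rmorphM rmorphXn /= frac_evalC.
Qed.

End FracEval.

(** * Relations with a unit coefficient *)

Section KrullAkizuki.
Variables (R : idomainType) (m : idealr R).
Hypotheses (noethR : noetherian R) (localR : local_with m).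
Hypothesis dimR : krull_dim_is R 1.

(** The quotient R / L has finite length: the last nonzero power of m in it is
    killed by m. *)
Lemma exists_socle L c : is_ideal L -> L c -> c != 0 -> ~ L 1 ->
  exists2 g, ~ L g & forall a, a \in m -> L (a * g).
Proof.
move=> iL Lc c0 L1.
have [n nL] := ideal_exp_sub_nonzero noethR localR dimR iL Lc c0.
elim: n nL => [nL|n IHn nL]; first by case: L1; apply: nL.
have [/IHn //|nn] := pselect (ideal_exp [set` m] n `<=` L).
have [g [mg nLg]] : exists g, ideal_exp [set` m] n g /\ ~ L g.
  apply: contrapT => nex; apply: nn => g mg; apply: contrapT => nLg.
  by apply: nex; exists g.
by exists g => // a ma; apply: nL; apply: ideal_expS.
Qed.

(** R / cR is artinian.  Take L maximal among the ideals on which the chain P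
    stabilizes.  If L were proper, a socle element g of R / L would give the
    one-dimensional space (L + g R) / L, whose subspace cut out by P n is
    either everything for all n or zero from some n on; in both cases the chain
    would also stabilize on L + g R. *)
Lemma descending_chain_stable (P : nat -> set R) c : c != 0 ->
  (forall n, is_ideal (P n)) -> (forall n, P n c) ->
  (forall n, P n.+1 `<=` P n) ->
  exists n0, forall n, (n0 <= n)%N -> P n0 `<=` P n.
Proof.
move=> c0 iP Pc PS.
have PM i j : (i <= j)%N -> P j `<=` P i.
  move=> /subnKC <-; elim: (j - i)%N => [|k IHk]; first by rewrite addn0.
  by rewrite addnS => x /PS /IHk.
pose Phi L := [/\ is_ideal L, L c &
  exists n0, forall n z, (n0 <= n)%N -> P n0 z -> L z -> P n z].
have Phi0 : Phi (principal c).
  split; [exact: is_ideal_principal|by exists 1; rewrite mul1r|].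
  exists 0%N => n _ _ _ [a ->]; case: (iP n) => _ _; exact.
have [L [iL Lc [n0 n0P]] Lmax] :=
  noetherian_max noethR (Phi := Phi) (fun J '(And3 iJ _ _) => iJ) Phi0.
have [_ LD LM] := iL.
have [L1|L1] := pselect (L 1).
  by exists n0 => n nn0 z Pz; apply: n0P => //; rewrite -[z]mulr1; apply: LM.
have [g nLg Lg] := exists_socle iL Lc c0 L1.
case: nLg; apply: (Lmax (ideal_add L g)); last exact: ideal_add_mem; last first.
  exact: sub_ideal_add.
split; [exact: is_ideal_add|exact: sub_ideal_add|].
have [[n1 n1P]|nn] := pselect (exists n, forall z, P n z -> ideal_add L g z -> L z).
  exists (maxn n0 n1) => n z; rewrite geq_max => /andP[nn0 _] Pz Lz.
  apply: n0P => //; first by move: z Pz {Lz}; apply: PM; exact: leq_maxl.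
  by apply: n1P => //; move: z Pz {Lz}; apply: PM; exact: leq_maxr.
(* Every P n meets L + g R outside L: subtract from z a multiple of such a w. *)
exists n0 => n z nn0 Pz [l' Ll' [u' zE]].
have [w [Pw [l Ll [u wE]] nLw]] : exists w, [/\ P n w, ideal_add L g w & ~ L w].
  apply: contrapT => nex; apply: nn; exists n => w Pw Lw; apply: contrapT => nLw.
  by apply: nex; exists w.
have Uu : u \is a GRing.unit.
  rewrite (local_unit noethR localR); apply/negP => mu; apply: nLw.
  by rewrite wE; apply: LD => //; apply: Lg.
have [_ PD PM'] := iP n.
have -> : z = (z - u' / u * w) + u' / u * w by rewrite subrK.
apply: PD; last exact: PM'.
apply: n0P => //.
  apply: idealB => //; case: (iP n0) => _ _; apply; move: Pw; exact: PM.
have -> : z - u' / u * w = l' - u' / u * l.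
  by rewrite zE wE mulrDr opprD addrACA mulrA divrK // subrr addr0.
by apply: idealB => //; apply: LM.
Qed.

(** The Krull-Akizuki argument.  Let f = y/x and W n = R :&: x^n R[f].  The
    chain W n + x R stabilizes, and this gives x^n R[f] in x^(n+1) R[f] + R for
    n large.  So R[f] / x R[f], which is x^n R[f] / x^(n+1) R[f], is generated
    by elements of R and is a finite R-module: modulo x, some f^d is a
    combination of lower powers of f, and the resulting relation has its
    coefficient of degree d in 1 + m. *)
Lemma exists_primitive_relation x y : x \in m -> x != 0 ->
  exists (G : {poly R}) d, frac_eval (y%:F / x%:F) G = 0 /\ G`_d \notin m.
Proof.
move=> mx x0; set f := y%:F / x%:F.
have xF0 : x%:F != 0 by rewrite tofrac_eq0.
pose W n : set R := [set r | exists h, r%:F = x%:F ^+ n * frac_eval f h].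
have iW n : is_ideal (W n).
  split; first by exists 0; rewrite !rmorph0 mulr0.
  - by move=> r s [h rE] [k sE]; exists (h + k); rewrite !rmorphD mulrDr /= rE sE.
  - move=> a r [h rE]; exists (a%:P * h); rewrite !rmorphM /= frac_evalC rE.
    exact: mulrCA.
have WS n : W n.+1 `<=` W n.
  move=> r [h rE]; exists (x%:P * h).
  by rewrite rE rmorphM /= frac_evalC exprSr mulrA.
have [n0 n0P] : exists n0, forall n, (n0 <= n)%N -> ideal_add (W n0) x `<=` ideal_add (W n) x.
  apply: (@descending_chain_stable _ x) => //.
  - by move=> n; apply: is_ideal_add.
  - by move=> n; apply: ideal_add_mem.
  - by move=> n _ [z Wz [a ->]]; exists z; [apply: WS|exists a].
have WM n : (n0 <= n)%N -> W n `<=` W n0.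
  move=> /subnKC <-; elim: (n - n0)%N => [|k IHk]; first by rewrite addn0.
  by rewrite addnS => z /WS /IHk.
(* Clear the denominator of h(f) by x^k, use stability, then divide by x once:
   this lowers k. *)
have desc k n h : (n0 <= n)%N -> (exists r, r%:F = x%:F ^+ (n + k) * frac_eval f h) ->
    exists h' t, x%:F ^+ n * frac_eval f h = x%:F ^+ n.+1 * frac_eval f h' + t%:F.
  elim: k n h => [|k IHk] n h nn0 [r rE].
    by exists 0, r; rewrite rmorph0 mulr0 add0r rE addn0.
  have: ideal_add (W n0) x r.
    apply: sub_ideal_add; apply: (WM (n + k.+1)%N); first exact: leq_trans (leq_addr _ _).
    by exists h.
  move=> /(n0P (n + k.+2)%N)[]; first exact: leq_trans (leq_addr _ _).
  move=> z [h1 zE] [a raE].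
  have [||h' [t hE]] := IHk n (h - x%:P * h1) => //.
    exists a; apply: (mulfI xF0); move: rE.
    rewrite raE !rmorphD /= zE !rmorphM /= rmorphN rmorphM /= frac_evalC !addnS !exprS.
    move=> rE; rewrite mulrC; apply: (addrI (x%:F * (x%:F * x%:F ^+ (n + k)) * frac_eval f h1)).
    rewrite rE; ring.
  exists (h' + h1), t; move: hE; rewrite !rmorphD /= rmorphN rmorphM /= frac_evalC exprS => hE.
  rewrite mulrDr addrAC -hE; ring.
have /choice[h'] : forall d, exists h' t : _, x%:F ^+ n0 * f ^+ d =
    x%:F ^+ n0.+1 * frac_eval f h' + t%:F.
  move=> d; have [||h' [t hE]] := desc d n0 'X^d => //.
    exists (x ^+ n0 * y ^+ d); rewrite rmorphXn /= frac_evalX rmorphM !rmorphXn /=.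
    by rewrite exprD -mulrA -exprMn [_ * f]mulrC divfK.
  by exists h', t; move: hE; rewrite rmorphXn /= frac_evalX.
move=> /choice[t tE].
have [d [c tdE]] := noetherian_dependence noethR t.
pose G := 'X^d - x%:P * h' d - \sum_(i < d) (c i)%:P * ('X^i - x%:P * h' i).
have tG i : x%:F ^+ n0 * frac_eval f ('X^i - x%:P * h' i) = (t i)%:F.
  rewrite rmorphD rmorphN rmorphM rmorphXn /= frac_evalC frac_evalX mulrDr tE exprS.
  ring.
exists G, d; split.
  apply: (mulfI (expf_neq0 n0 xF0)); rewrite mulr0 rmorphD rmorphN mulrDr mulrN /= tG.
  rewrite rmorph_sum /= mulr_sumr tdE rmorph_sum /= -sumrB big1 // => i _.
  by rewrite !rmorphM /= frac_evalC -tG; ring.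
have -> : G`_d = 1 - ((h' d)`_d - \sum_(i < d) c i * (h' i)`_d) * x.
  rewrite !coefB coefXn eqxx coefCM coef_sum.
  under eq_bigr => i _ do
    rewrite coefCM coefB coefXn coefCM gtn_eqF // sub0r mulrN mulrCA.
  rewrite sumrN -mulr_sumr.
  rewrite -[true%:R]/(1 : R); ring.
apply/negP => mG; have := idealr1 m.
by rewrite -(subrK (((h' d)`_d - \sum_(i < d) c i * (h' i)`_d) * x) 1) rpredD ?idealMr.
Qed.

End KrullAkizuki.

(** * Polynomials modulo the maximal ideal *)

Section ResidueField.
Variables (R : idomainType) (m : idealr R).
Hypotheses (noethR : noetherian R) (localR : local_with m).
Hypothesis closed_residue : GRing.closed_field_axiom {ideal_quot m}.

Lemma exists_root_mod (P : {poly R}) : P \is monic -> (1 < size P)%N ->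
  exists a, P.[a] \in m.
Proof.
move=> /monicP lcP sP; set n := (size P).-1.
have n0 : (0 < n)%N by rewrite /n -subn1 subn_gt0.
have [x xE] := closed_residue (fun i => (\pi_{ideal_quot m} (- P`_i))%qT) n0.
exists (repr x); have sPE : size P = n.+1 by rewrite prednK // ltnW.
rewrite horner_coef sPE big_ord_recr /= -/n -[P`_n]/(lead_coef P) lcP mul1r addrC.
rewrite -[X in _ + X]opprK Quotient.idealrBE rmorphXn /= reprK xE -sumrN rmorph_sum.
apply/eqP/eq_bigr => i _; rewrite -mulNr rmorphM rmorphXn /= reprK.
by [].
Qed.

(** A polynomial that is nonzero modulo m takes a unit value, since the residue
    field is infinite; over an algebraically closed field this is seen directly
    by solving G = lead_coef G. *)
Lemma exists_unit_value (G : {poly R}) d : G`_d \notin m ->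
  exists a, G.[a] \notin m.
Proof.
move=> Gd.
have exG : exists n, G`_n \notin m by exists d.
have leG n : G`_n \notin m -> (n <= size G)%N.
  by move=> Gn; apply: contraNT Gn; rewrite -ltnNge => /ltnW /(nth_default 0) ->; exact: idealr0.
(* G1 drops the coefficients above the degree of G modulo m. *)
have [n Gn nmax] := ex_maxnP exG leG.
have Un : G`_n \is a GRing.unit by rewrite (local_unit noethR localR).
pose G1 := \poly_(i < n.+1) G`_i.
have GG1 a : G.[a] - G1.[a] \in m.
  rewrite -hornerN -hornerD horner_coef; apply: rpred_sum => i _.
  rewrite coefB coef_poly mulrC; apply: idealMr.
  case: ltnP => [_|ni]; first by rewrite subrr idealr0.
  by rewrite subr0; apply: contraLR ni => /nmax; rewrite -ltnNge ltnS.
have [n0|n0] := posnP n.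
  exists 0; rewrite horner_coef0 -n0 //.
pose P := (G`_n)^-1 *: G1 - 1.
have sG1 : size ((G`_n)^-1 *: G1) = n.+1.
  rewrite size_scale ?invr_eq0; last by apply: contraNneq Gn => ->; exact: idealr0.
  by rewrite size_poly_eq //; apply: contraNneq Gn => ->; exact: idealr0.
have sP : size P = n.+1.
  by rewrite size_polyDl sG1 // size_polyN size_poly1.
have mP : P \is monic.
  rewrite monicE lead_coefDl ?size_polyN ?size_poly1 ?sG1 // lead_coefE sG1 /=.
  by rewrite coefZ coef_poly ltnSn mulVr.
have [|a Pa] := exists_root_mod mP; first by rewrite sP.
exists a; apply/negP => Ga.
have /negP[] := negbT (idealr1 m).
have G1a : G1.[a] \in m by rewrite -[G1.[a]](subKr G.[a]) rpredB.
rewrite -(subKr ((G`_n)^-1 * G1.[a]) 1) rpredB ?idealMr //.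
by move: Pa; rewrite /P hornerD hornerZ hornerN hornerC.
Qed.

End ResidueField.

(** * Integral and almost integral fractions *)

Section IntegralElements.
Variable R : idomainType.
Implicit Types f g : {fraction R}.

(** The polynomial G(X + a) has constant term G(a) and the root f - a; reversing
    its coefficients gives a polynomial with root 1/(f - a) whose leading
    coefficient is the unit G(a). *)
Lemma inverse_integral (f : {fraction R}) G a : frac_eval f G = 0 ->
  G.[a] \is a GRing.unit ->
  f - a%:F != 0 /\ exists2 P, P \is monic & frac_eval (f - a%:F)^-1 P = 0.
Proof.
move=> fG Ua; set g := f - a%:F; pose H := G \Po ('X + a%:P).
have H0E : H`_0 = G.[a] by rewrite -horner_coef0 horner_comp !hornerE.
have gH : frac_eval g H = 0.
  by rewrite frac_eval_comp rmorphD /= frac_evalX frac_evalC subrK.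
have H0 : H`_0 != 0 by rewrite H0E; apply: contraTneq Ua => ->; rewrite unitr0.
have g0 : g != 0.
  apply: contraNneq H0 => gE; move: gH; rewrite gE frac_evalE => /eqP.
  case E: (size H) => [|n]; first by rewrite (nth_default 0) ?E.
  rewrite big_ord_recl /= expr0 mulr1 big1 ?addr0 ?tofrac_eq0 // => i _.
  by rewrite expr0n mulr0.
split=> //; set n := (size H).-1.
have sH : size H = n.+1.
  by rewrite prednK // size_poly_gt0; apply: contraNneq H0 => ->; rewrite coef0.
pose E i := H`_(n - i) / H`_0.
have En : E n = 1 by rewrite /E subnn divrr // H0E.
exists (\poly_(i < n.+1) E i).
  rewrite monicE lead_coefE size_poly_eq ?En ?oner_neq0 //=.
  by rewrite coef_poly ltnSn En.
rewrite frac_eval_sum (reindex_inj rev_ord_inj) /=.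
transitivity ((H`_0)^-1%:F * (g^-1) ^+ n * frac_eval g H); last by rewrite gH mulr0.
rewrite frac_evalE sH mulr_sumr; apply: eq_bigr => i _.
have le_in : (i <= n)%N by rewrite -ltnS.
rewrite subSS /E subKn // rmorphM /=.
have -> : g^-1 ^+ n = g^-1 ^+ (n - i) * g^-1 ^+ i by rewrite -exprD subnK.
have gi : g^-1 ^+ i * g ^+ i = 1 by rewrite -exprMn mulVf // expr1n.
rewrite -[LHS]mulr1 -gi; move: (g^-1 ^+ _) (g^-1 ^+ _) (g ^+ _) => u v w.
by move: (tofrac (H`_0)^-1) (tofrac H`_i) => b c; ring.
Qed.

Definition almost_integral f :=
  exists2 c : R, c != 0 & forall n, exists r : R, c%:F * f ^+ n = r%:F.

Lemma almost_integral_tofrac (a : R) : almost_integral a%:F.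
Proof.
by exists 1; rewrite ?oner_neq0 // => n; exists (a ^+ n); rewrite rmorphXn mul1r.
Qed.

Lemma almost_integralM f g : almost_integral f -> almost_integral g -> almost_integral (f * g).
Proof.
move=> [c c0 cf] [d d0 dg]; exists (c * d); first exact: mulf_neq0.
move=> n; have [[r rE] [s sE]] := (cf n, dg n); exists (r * s).
by rewrite !rmorphM /= -rE -sE exprMn mulrACA.
Qed.

Lemma almost_integralD f g : almost_integral f -> almost_integral g -> almost_integral (f + g).
Proof.
move=> [c c0 cf] [d d0 dg]; exists (c * d); first exact: mulf_neq0.
have [[r rE] [s sE]] := (choice cf, choice dg).
move=> n; exists (\sum_(i < n.+1) r (n - i)%N * s i *+ 'C(n, i)).
rewrite exprDn mulr_sumr rmorph_sum; apply: eq_bigr => i _.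
by rewrite rmorphMn !rmorphM /= -rE -sE mulrnAr mulrACA.
Qed.

Lemma almost_integral_exp f n : almost_integral f -> almost_integral (f ^+ n).
Proof.
by move=> [c c0 cf]; exists c => // k; rewrite -exprM.
Qed.

Lemma almost_integral_frac_eval f h : almost_integral f -> almost_integral (frac_eval f h).
Proof.
move=> bf; elim/poly_ind: h => [|h a IHh].
  by rewrite rmorph0 -(rmorph0 (@tofrac R)); exact: almost_integral_tofrac.
rewrite rmorphD rmorphM /= frac_evalC frac_evalX.
by apply: almost_integralD; [exact: almost_integralM|exact: almost_integral_tofrac].
Qed.

(** Powers below the degree n of P have the denominator z^n, and the monic
    equation expresses the higher ones by them. *)
Lemma integral_imp_almost (x z : R) P : z != 0 -> P \is monic ->
  frac_eval (x%:F / z%:F) P = 0 -> almost_integral (x%:F / z%:F).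
Proof.
move=> z0 /monicP lcP; set u := _ / _; set n := (size P).-1.
have zF0 : z%:F != 0 by rewrite tofrac_eq0.
have sP : size P = n.+1.
  by rewrite prednK // size_poly_gt0 -lead_coef_eq0 lcP oner_neq0.
rewrite frac_evalE sP big_ord_recr /= -/n -[P`_n]/(lead_coef P) lcP.
rewrite rmorph1 mul1r addrC => /eqP; rewrite addr_eq0 => /eqP un.
exists (z ^+ n); first exact: expf_neq0.
elim/ltn_ind=> k IHk; have [kn|nk] := ltnP k n.
  exists (z ^+ (n - k) * x ^+ k); rewrite rmorphM !rmorphXn /=.
  by rewrite -{1}(subnK (ltnW kn)) exprD -mulrA -exprMn mulrCA divff // mulr1.
have /choice[r rE] : forall i : 'I_n, exists r : R,
    z%:F ^+ n * u ^+ (k - n + i) = r%:F.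
  move=> i; rewrite -rmorphXn; apply: IHk.
  by rewrite -{2}(subnK nk) ltn_add2l.
exists (- \sum_(i < n) P`_i * r i).
rewrite -{1}(subnK nk) exprD un !mulrN rmorphN rmorph_sum /= !mulr_sumr; congr (- _).
by apply: eq_bigr => i _; rewrite rmorphM /= -rE exprD rmorphXn /=; ring.
Qed.

End IntegralElements.

(** * Frobenius powers *)

Section Frobenius.
Variables (A : comNzRingType) (p : nat).
Hypothesis charA : p \in [pchar A].
Implicit Types (x y : A) (e : nat).

Lemma frobD x y e : (x + y) ^+ (p ^ e) = x ^+ (p ^ e) + y ^+ (p ^ e).
Proof.
apply: exprDn_pchar.
by rewrite (eq_pnat _ (pcharf_eq charA)) pnatX pnat_id ?(pcharf_prime charA).
Qed.

Lemma frob_gt0 e : (0 < p ^ e)%N.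
Proof. by rewrite expn_gt0 prime_gt0 ?(pcharf_prime charA). Qed.

Lemma frob_gt e : (e < p ^ e)%N.
Proof. by apply/ltn_expl/prime_gt1; rewrite (pcharf_prime charA). Qed.

Lemma frobN x e : (- x) ^+ (p ^ e) = - x ^+ (p ^ e).
Proof.
by apply/eqP; rewrite -addr_eq0 -frobD addNr expr0n gtn_eqF ?frob_gt0.
Qed.

Lemma frobB x y e : (x - y) ^+ (p ^ e) = x ^+ (p ^ e) - y ^+ (p ^ e).
Proof. by rewrite frobD frobN. Qed.

Lemma frob_sum (T : Type) (s : seq T) (F : T -> A) e :
  (\sum_(i <- s) F i) ^+ (p ^ e) = \sum_(i <- s) F i ^+ (p ^ e).
Proof.
elim/big_rec2: _ => [|i y z _ <-]; last exact: frobD.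
by rewrite expr0n gtn_eqF // frob_gt0.
Qed.

End Frobenius.

Section FrobeniusIdeals.
Variables (A : comNzRingType) (p : nat).
Hypothesis charA : p \in [pchar A].

Lemma is_ideal_frob_preimage (J : set A) e :
  is_ideal J -> is_ideal [set y | J (y ^+ (p ^ e))].
Proof.
move=> [J0 JD JM].
split=> /=; first by rewrite expr0n gtn_eqF // (frob_gt0 charA).
- by move=> y z Jy Jz; rewrite (frobD charA); apply: JD.
- by move=> a y Jy; rewrite exprMn; apply: JM.
Qed.

(** Raising to the power p^k is a ring endomorphism, so generators suffice. *)
Lemma frobenius_power_frob (I : set A) e k x : frobenius_power I (p ^ e) x ->
  frobenius_power I (p ^ (e + k)) (x ^+ (p ^ k)).
Proof.
move: x; apply: ideal_gen_min; first exact: (is_ideal_frob_preimage k (is_ideal_gen _)).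
by move=> _ [y Iy <-] /=; rewrite -exprM -expnD; apply: sub_ideal_gen; exists y.
Qed.

Lemma multiple_raise (x y r : A) e k : y ^+ (p ^ e) = r * x ^+ (p ^ e) ->
  y ^+ (p ^ (e + k)) = r ^+ (p ^ k) * x ^+ (p ^ (e + k)).
Proof. by move=> yE; rewrite expnD !exprM yE exprMn. Qed.

Lemma ideal_exp_frob_multiple (I : set A) x e i a :
  (forall y, I y -> principal (x ^+ (p ^ e)) (y ^+ (p ^ e))) ->
  ideal_exp I i a -> principal (x ^+ (p ^ e * i)) (a ^+ (p ^ e)).
Proof.
move=> Ix; elim: i a => [|i IHi] a.
  by exists (a ^+ (p ^ e)); rewrite muln0 mulr1.
have iJ := is_ideal_frob_preimage e (is_ideal_principal (x ^+ (p ^ e * i.+1))).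
move: a; apply: (ideal_expS_min iJ).
move=> y z /Ix[r rE] /IHi[s sE]; exists (r * s).
by rewrite exprMn rE sE mulnS exprD mulrACA.
Qed.

End FrobeniusIdeals.

(** * Integral elements over a complete local domain *)

Section CompleteLocal.
Variables (R : idomainType) (p : nat) (m : idealr R).
Hypotheses (charRp : p \in [pchar R]) (noethR : noetherian R).
Hypotheses (localR : local_with m) (dimR : krull_dim_is R 1).
Hypothesis completeR : adically_complete [set` m].
Implicit Types f g z : {fraction R}.

Let charK : p \in [pchar {fraction R}].
Proof. exact: (rmorph_pchar (@tofrac R) charRp). Qed.

Local Notation M k := (ideal_exp [set` m] k).

(** A weak Artin-Rees property: the m-adic topology of cR is the induced one,
    because some power of m is contained in cR. *)
Lemma adic_sub_multiples c k : c != 0 ->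
  exists N, forall r, M N r -> exists2 s, M k s & r = c * s.
Proof.
move=> c0.
have [|n nc] := ideal_exp_sub_nonzero noethR localR dimR (is_ideal_principal c) _ c0.
  by exists 1; rewrite mul1r.
have [M0 MD MM] := is_ideal_exp [set` m] k.
exists (n + k)%N => r; apply: (@ideal_expD_min R _ [set r | exists2 s, M k s & r = c * s]).
  split; first by exists 0; rewrite ?mulr0.
  - by move=> _ _ [s Ms ->] [t Mt ->]; exists (s + t); rewrite ?mulrDr //; apply: MD.
  - by move=> a _ [s Ms ->]; exists (a * s); rewrite 1?mulrCA //; apply: MM.
move=> _ y /nc[a ->] My; exists (a * y); first exact: MM.
by rewrite mulrCA mulrA.
Qed.

(** For almost integral z this means that the powers of z tend to 0, or that z
    lies in the maximal ideal of the integral closure of R.  Asking for an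
    exponent p^e makes closure under addition immediate. *)
Definition top_nilpotent z := exists e r, r \in m /\ z ^+ (p ^ e) = r%:F.

Lemma top_nil_tofrac r : r \in m -> top_nilpotent r%:F.
Proof. by move=> mr; exists 0%N, r; rewrite expr1. Qed.

Lemma top_nil_raise z e r k : r \in m -> z ^+ (p ^ e) = r%:F ->
  r ^+ (p ^ k) \in m /\ z ^+ (p ^ (e + k)) = (r ^+ (p ^ k))%:F.
Proof.
move=> mr zr; split; last by rewrite expnD exprM zr rmorphXn.
by rewrite -(prednK (frob_gt0 charRp k)) exprSr idealMr.
Qed.

Lemma top_nil_frob z e : top_nilpotent (z ^+ (p ^ e)) -> top_nilpotent z.
Proof.
by move=> [e' [r [mr zr]]]; exists (e + e')%N, r; rewrite expnD exprM.
Qed.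

Lemma top_nilD y z : top_nilpotent y -> top_nilpotent z -> top_nilpotent (y + z).
Proof.
move=> [e [r [mr yr]]] [e' [r' [mr' zr]]].
have [my yE] := top_nil_raise e' mr yr.
have [mz zE] := top_nil_raise e mr' zr.
exists (e + e')%N, (r ^+ (p ^ e') + r' ^+ (p ^ e)); split; first exact: rpredD.
by rewrite (frobD charK) yE addnC zE rmorphD.
Qed.

(** If z^q = r in m, then (y z)^(q q') = y^(q q') r^q', and r^q' absorbs the
    common denominator c of the powers of y once q' is large. *)
Lemma top_nilM y z : almost_integral y -> top_nilpotent z -> top_nilpotent (y * z).
Proof.
move=> [c c0 cy] [e [r [mr zr]]].
have [N Nc] := adic_sub_multiples 1 c0.
have [t tE] := cy (p ^ (e + N))%N.
have [s Ms rE] : exists2 s, M 1 s & r ^+ (p ^ N) = c * s.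
  apply: Nc; apply: (ideal_exp_le (ltnW (frob_gt charRp N))).
  exact: ideal_exprn.
have ms : s \in m := ideal_exp1_sub (is_ideal_idealr m) Ms.
exists (e + N)%N, (t * s); split; first exact: idealMr.
have [_ zE] := top_nil_raise N mr zr.
by rewrite exprMn zE rE !rmorphM /= -tE mulrCA mulrA.
Qed.

(** Lifting of idempotents by Frobenius.  Since e^2 - e divides e^p - e, the
    difference e^(pq) - e^q is a multiple of n^q; so the elements c e^q of R,
    where c is a common denominator, form a Cauchy sequence.  Its limit l
    satisfies l^2 = c l, and R being a domain, l = 0 or l = c. *)
Lemma idempotent_lift_aux e n : almost_integral e -> n \in m -> e ^+ 2 - e = n%:F ->
  top_nilpotent e \/ top_nilpotent (1 - e).
Proof.
move=> be mn eE; have [c1 c10 c1e] := be.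
have p1 : (1 < p)%N by rewrite prime_gt1 ?(pcharf_prime charRp).
(* h is the geometric sum in e^p - e = (e^2 - e) (1 + e + ... + e^(p - 2)). *)
pose h := frac_eval e (\poly_(i < p.-1) 1).
have epE : e ^+ p - e = n%:F * h.
  rewrite -(prednK (ltnW p1)) exprS -{3}[e]mulr1 -mulrBr subrX1 mulrA mulrBr mulr1.
  rewrite -expr2 eE /h frac_eval_sum; congr (_ * _).
  by apply: eq_bigr => i _; rewrite rmorph1 mul1r.
have [c2 c20 c2h] : almost_integral h by exact: almost_integral_frac_eval.
have [c [c0 ce ch]] : exists c : R, [/\ c != 0,
    forall k, exists r : R, c%:F * e ^+ k = r%:F &
    forall k, exists r : R, c%:F * h ^+ k = r%:F].
  exists (c1 * c2); split=> [|k|k]; first exact: mulf_neq0.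
  - by have [r rE] := c1e k; exists (c2 * r); rewrite !rmorphM /= -rE mulrA [c1%:F * _]mulrC.
  - by have [r rE] := c2h k; exists (c1 * r); rewrite !rmorphM /= -rE mulrA.
have /choice[s sE] : forall j, exists r, c%:F * e ^+ (p ^ j) = r%:F by move=> j.
have nM j : M j (n ^+ (p ^ j)).
  by apply: (ideal_exp_le (ltnW (frob_gt charRp j))); apply: ideal_exprn.
have sS j : M j (s j.+1 - s j).
  have [r rE] := ch (p ^ j)%N.
  have -> : s j.+1 - s j = r * n ^+ (p ^ j).
    apply/eqP; rewrite -tofrac_eq rmorphB rmorphM rmorphXn /= -!sE -rE expnS exprM.
    by rewrite -mulrBr -(frobB charK) epE exprMn mulrA mulrAC.
  by case: (is_ideal_exp [set` m] j) => _ _; apply.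
have sM k j : (k <= j)%N -> M k (s j - s k).
  move=> /subnKC <-; elim: (j - k)%N => [|i IHi].
    by rewrite addn0 subrr; case: (is_ideal_exp [set` m] k).
  rewrite addnS -(subrKA (s (k + i)%N)); case: (is_ideal_exp [set` m] k) => _ D _.
  by apply: D => //; apply: ideal_exp_le (sS _); exact: leq_addr.
have [|l lP] := completeR.2 s.
  move=> k; exists k => i j ki kj; have -> : s i - s j = (s i - s k) - (s j - s k) by ring.
  exact: idealB (is_ideal_exp _ _) (sM _ _ ki) (sM _ _ kj).
have s2 j : s j ^+ 2 - c * s j = c ^+ 2 * n ^+ (p ^ j).
  apply/eqP; rewrite -tofrac_eq rmorphB !rmorphM !rmorphXn /= -!sE -eE (frobB charK).
  by rewrite -[(e ^+ 2) ^+ _]exprM mulnC exprM; apply/eqP; ring.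
have [l0|lc] : l = 0 \/ l = c.
- suff /eqP : l * (l - c) = 0.
    by rewrite mulf_eq0 subr_eq0 => /orP[]/eqP; [left|right].
  apply: completeR.1 => k; have [N NP] := lP k.
  set j := maxn N k.
  have -> : l * (l - c) = c ^+ 2 * n ^+ (p ^ j) - (s j + l - c) * (s j - l).
    by rewrite -s2; ring.
  apply: idealB; first exact: is_ideal_exp.
    case: (is_ideal_exp [set` m] k) => _ _; apply.
    by apply: ideal_exp_le (nM j); exact: leq_maxr.
  case: (is_ideal_exp [set` m] k) => _ _; apply; apply: NP; exact: leq_maxl.
- have [N Nc] := adic_sub_multiples 1 c0.
  have [j /(_ j (leqnn j))] := lP N; rewrite l0 subr0 => /Nc[t Mt tE].
  left; exists j, t; split; first exact: ideal_exp1_sub (is_ideal_idealr m) _ Mt.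
  apply: (mulfI (_ : c%:F != 0)); first by rewrite tofrac_eq0.
  by rewrite sE tE rmorphM.
- have [N Nc] := adic_sub_multiples 1 c0.
  have [j /(_ j (leqnn j))] := lP N; rewrite lc => /Nc[t Mt tE].
  right; exists j, (- t); split.
    by rewrite rpredN; exact: ideal_exp1_sub (is_ideal_idealr m) _ Mt.
  apply: (mulfI (_ : c%:F != 0)); first by rewrite tofrac_eq0.
  by rewrite (frobB charK) expr1n mulrBr mulr1 sE rmorphN mulrN -rmorphM /= -tE rmorphB opprB.
Qed.

Lemma top_nil_idempotent e : almost_integral e -> top_nilpotent (e ^+ 2 - e) ->
  top_nilpotent e \/ top_nilpotent (1 - e).
Proof.
move=> be [k [n [mn nE]]].
have [|||/top_nil_frob|] := @idempotent_lift_aux (e ^+ (p ^ k)) n; first exact: almost_integral_exp.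
- exact: mn.
- by rewrite -exprM mulnC exprM -(frobB charK).
- by left.
- by move=> ne; right; apply: (@top_nil_frob _ k); rewrite (frobB charK) expr1n.
Qed.

Hypothesis closed_residue : GRing.closed_field_axiom {ideal_quot m}.

(** The residue field of R[u] is that of R, and R[u] is local.  Take P monic of
    least degree with P(u) topologically nilpotent, let a be a root of P modulo
    m, and write P = Q (X - a) and Q = Q' (X - a) + Q(a), the first modulo m.
    If Q(a) is in m, then Q^2 and hence Q is topologically nilpotent at u.  If
    Q(a) is a unit, then Q(u)/Q(a) is idempotent up to topologically nilpotent
    elements, so that Q or Q' (X - a) is topologically nilpotent at u.  Both
    contradict the choice of P, unless P is X - a or 1. *)
Lemma integral_residue u P : almost_integral u -> P \is monic -> frac_eval u P = 0 ->
  exists a : R, top_nilpotent (u - a%:F).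
Proof.
move=> bu mP uP; pose ev := frac_eval u.
have bev Q : almost_integral (ev Q) by exact: almost_integral_frac_eval.
pose deg n := `[<exists Q, [/\ Q \is monic, size Q = n & top_nilpotent (ev Q)]>].
have exdeg : exists n, deg n.
  exists (size P); apply/asboolP; exists P; split=> //.
  by rewrite /ev uP -(rmorph0 (@tofrac R)); apply: top_nil_tofrac; exact: idealr0.
have {P mP uP exdeg} [n /asboolP[P [mP sP nP]] nmin] := ex_minnP exdeg.
have {deg nmin} Pmin Q : Q \is monic -> top_nilpotent (ev Q) -> (size P <= size Q)%N.
  by move=> mQ nQ; rewrite sP; apply: nmin; apply/asboolP; exists Q.
have size1 (Q : {poly R}) : Q \is monic -> (size Q <= 1)%N -> Q = 1.
  by move=> mQ sQ; rewrite [Q]size1_polyC // -(lead_coefC Q`_0) -size1_polyC // (monicP mQ).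
have [sP1|sP1] := leqP (size P) 1.
  exists 0; rewrite rmorph0 subr0 -[u]mulr1; apply: top_nilM => //.
  by move: nP; rewrite (size1 P) // /ev rmorph1.
have [a ma] := exists_root_mod closed_residue mP sP1.
have splitX Q : Q \is monic -> (1 < size Q)%N -> exists Q',
    [/\ Q' \is monic, size Q = (size Q').+1 & Q - Q.[a]%:P = Q' * ('X - a%:P)].
  move=> mQ sQ.
  have /factor_theorem[Q' Q'E] : root (Q - Q.[a]%:P) a.
    by rewrite rootE !hornerE subrr.
  have sC : (size (- Q.[a]%:P) < size Q)%N.
    by rewrite size_polyN; apply: leq_ltn_trans (size_polyC_leq1 _) sQ.
  have mQ' : Q' \is monic.
    by rewrite -(monicMr _ (monicXsubC a)) -Q'E monicE lead_coefDl // -monicE.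
  exists Q'; split=> //; rewrite -(size_polyDl sC) Q'E.
  by rewrite size_Mmonic ?monic_neq0 ?monicXsubC // size_XsubC addn2.
have [Q [mQ sQ QE]] := splitX P mP sP1.
have ma_nil r : r \in m -> top_nilpotent (ev r%:P).
  by move=> mr; rewrite /ev frac_evalC; apply: top_nil_tofrac.
have nilX : top_nilpotent (ev (Q * ('X - a%:P))).
  rewrite -QE /ev rmorphB; apply: top_nilD => //.
  by rewrite -rmorphN -polyCN; apply: ma_nil; rewrite rpredN.
have nQ : ~ top_nilpotent (ev Q) by move=> /(Pmin Q mQ); rewrite sQ ltnn.
have [sQ1|sQ1] := leqP (size Q) 1.
  by exists a; move: nilX; rewrite (size1 Q) // mul1r /ev rmorphB /= frac_evalX frac_evalC.
have [Q' [mQ' sQ' Q'E]] := splitX Q mQ sQ1.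
exfalso.
have sQX : size (Q' * ('X - a%:P)) = size Q.
  by rewrite size_Mmonic ?monic_neq0 ?monicXsubC // size_XsubC addn2.
have nQX : ~ top_nilpotent (ev (Q' * ('X - a%:P))).
  have mQX : Q' * ('X - a%:P) \is monic by rewrite monicMr // monicXsubC.
  by move=> /(Pmin _ mQX); rewrite sQX sQ ltnn.
have nilQQ' : top_nilpotent (ev (Q * (Q' * ('X - a%:P)))).
  by rewrite mulrCA /ev rmorphM; apply: top_nilM.
have [mQa|] := boolP (Q.[a] \in m).
  apply: nQ; apply: (@top_nil_frob _ 1); rewrite expn1.
  have p1 : (1 < p)%N by rewrite prime_gt1 ?(pcharf_prime charRp).
  rewrite -(subnK p1) exprD; apply: top_nilM; first exact: almost_integral_exp.
  rewrite expr2 -rmorphM -{2}(subrK Q.[a]%:P Q) Q'E mulrDr rmorphD.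
  by apply: top_nilD => //; rewrite rmorphM; apply: top_nilM => //; apply: ma_nil.
rewrite -(local_unit noethR localR) => Ua.
pose w := Q.[a]^-1; pose e := ev (w%:P * Q).
have eE : 1 - e = ev (- w%:P * (Q' * ('X - a%:P))).
  rewrite /e -(rmorph1 ev) -rmorphB; congr (ev _).
  by rewrite -Q'E mulrBr !mulNr -polyCM mulVr // opprK addrC.
have [||ne|ne] := @top_nil_idempotent e; first exact: bev.
- have -> : e ^+ 2 - e = ev (w%:P * w%:P) * ev (Q * (Q' * ('X - a%:P))).
    rewrite -[LHS]opprB -{1}[e]mul1r expr2 -mulrBl eE /e -!rmorphM -rmorphN; congr (ev _).
    by ring.
  exact: top_nilM.
- apply: nQ; have -> : ev Q = ev Q.[a]%:P * e.
    by rewrite /e -rmorphM mulrA -polyCM mulrV // mul1r.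
  exact: top_nilM.
- apply: nQX.
  have -> : ev (Q' * ('X - a%:P)) = ev (- Q.[a]%:P) * (1 - e).
    by rewrite eE -rmorphM mulrA mulrNN -polyCM mulrV // mul1r.
  exact: top_nilM.
Qed.

(** By Frobenius, u^q = a^q + (u - a)^q, where both summands are in R. *)
Lemma integral_frob u P : almost_integral u -> P \is monic -> frac_eval u P = 0 ->
  exists e (r : R), u ^+ (p ^ e) = r%:F.
Proof.
move=> bu mP uP; have [a [e [r [_ rE]]]] := integral_residue bu mP uP.
exists e, (r + a ^+ (p ^ e)); rewrite rmorphD rmorphXn /= -rE.
by rewrite (frobB charK) subrK.
Qed.

End CompleteLocal.

(** * Divisibility up to Frobenius, and the closures *)

Section Comparison.
Variables (R : idomainType) (p : nat) (m : idealr R).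
Hypotheses (charRp : p \in [pchar R]) (noethR : noetherian R).
Hypotheses (localR : local_with m) (dimR : krull_dim_is R 1).
Hypothesis completeR : adically_complete [set` m].
Hypothesis closed_residue : GRing.closed_field_axiom {ideal_quot m}.

Lemma unit_1D r : r \in m -> 1 + r \is a GRing.unit.
Proof.
move=> mr; rewrite (local_unit noethR localR); apply/negP => m1r.
by have := idealr1 m; rewrite -(addrK r 1) rpredB.
Qed.

(** With f, a and u as in [inverse_integral], u = x / (y - a x), and u^q = r in
    R reads x^q (1 + a^q r) = r y^q: divide by r if it is a unit, and otherwise
    by 1 + a^q r. *)
Lemma frob_comparable (x y : R) : exists e,
  (exists r : R, y ^+ (p ^ e) = r * x ^+ (p ^ e)) \/
  (exists r : R, x ^+ (p ^ e) = r * y ^+ (p ^ e)).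
Proof.
have [->|x0] := eqVneq x 0.
  by exists 0%N; right; exists 0; rewrite !expr1 mul0r.
have [mx|] := boolP (x \in m); last first.
  rewrite -(local_unit noethR localR) => Ux.
  by exists 0%N; left; exists (y / x); rewrite !expr1 divrK.
have [G [d [fG Gd]]] := exists_primitive_relation noethR localR dimR y mx x0.
have [a] := exists_unit_value noethR localR closed_residue Gd.
rewrite -(local_unit noethR localR) => Ua.
have [] := inverse_integral fG Ua.
pose z := y - a * x.
have xF0 : x%:F != 0 by rewrite tofrac_eq0.
have -> : y%:F / x%:F - a%:F = z%:F / x%:F.
  by rewrite rmorphB rmorphM /= mulrBl mulfK.
rewrite mulf_eq0 negb_or tofrac_eq0 invf_div => /andP[z0 _] [P mP uP].
have bu := integral_imp_almost z0 mP uP.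
have [e [r rE]] := integral_frob charRp noethR localR dimR completeR closed_residue bu mP uP.
have {}rE : x ^+ (p ^ e) = r * (y ^+ (p ^ e) - a ^+ (p ^ e) * x ^+ (p ^ e)).
  apply/eqP; rewrite -exprMn -(frobB charRp) -/z -tofrac_eq rmorphM !rmorphXn /= -rE.
  by rewrite expr_div_n divfK // expf_neq0 // tofrac_eq0.
exists e; have [mr|] := boolP (r \in m).
  right; have U1 := unit_1D (idealMr (a ^+ (p ^ e)) mr).
  exists (r / (1 + a ^+ (p ^ e) * r)).
  apply: (mulrI U1); rewrite mulrA mulrCA mulrV // mulr1 mulrDl mul1r {1}rE; ring.
rewrite -(local_unit noethR localR) => Ur.
left; exists (r^-1 + a ^+ (p ^ e)); apply: (mulrI Ur).
rewrite mulrA mulrDr mulrV // mulrDl mul1r {1}rE; ring.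
Qed.

(** Up to Frobenius, divisibility is a total preorder on the finitely many
    generators of I, so one of them divides all the others. *)
Lemma frob_principal (I : set R) : is_ideal I -> exists2 x, I x &
  exists e, forall y, I y -> principal (x ^+ (p ^ e)) (y ^+ (p ^ e)).
Proof.
move=> /noethR[s ->].
suff [x Ix [e xP]] : exists2 x, ideal_gen [set` s] x &
    exists e, forall y, y \in s -> principal (x ^+ (p ^ e)) (y ^+ (p ^ e)).
  exists x => //; exists e.
  have iJ := is_ideal_frob_preimage charRp e (is_ideal_principal (x ^+ (p ^ e))).
  exact: (ideal_gen_min iJ).
elim: s => [|y s [x Ix [e xP]]].
  by exists 0; [case: (is_ideal_gen [set` ([::] : seq R)])|exists 0%N].
have Iy : ideal_gen [set` y :: s] y by apply: sub_ideal_gen; exact: mem_head.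
have {}Ix : ideal_gen [set` y :: s] x.
  move: x Ix {xP}; apply: ideal_gen_min; first exact: is_ideal_gen.
  by move=> z zs; apply: sub_ideal_gen; apply: mem_behead.
have [e' [[r yE]|[r xE]]] := frob_comparable x y.
  exists x => //; exists (e + e')%N => z; rewrite inE => /predU1P[->|/xP[t tE]].
    by exists (r ^+ (p ^ e)); rewrite addnC; apply: multiple_raise.
  by exists (t ^+ (p ^ e')); apply: multiple_raise.
exists y => //; exists (e + e')%N => z; rewrite inE => /predU1P[->|/xP[t tE]].
  by exists 1; rewrite mul1r.
exists (t ^+ (p ^ e') * r ^+ (p ^ e)).
rewrite (multiple_raise e' tE) -mulrA; congr (_ * _).
by rewrite addnC; apply: multiple_raise.
Qed.

(** If instead x^q = r y^q with r in m, then c y^q' in (x^q') makes c a multiple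
    of r^(q'/q) for all large q', and c = 0 by separatedness. *)
Lemma frob_multiple_of_almost (c x y : R) e0 : c != 0 ->
  (forall e, (e0 <= e)%N -> principal (x ^+ (p ^ e)) (c * y ^+ (p ^ e))) ->
  exists e, principal (x ^+ (p ^ e)) (y ^+ (p ^ e)).
Proof.
move=> c0 cy; have [e [xy|[r xE]]] := frob_comparable x y; first by exists e.
have [->|y0] := eqVneq y 0.
  by exists 0%N; exists 0; rewrite !expr1 mul0r.
have [mr|] := boolP (r \in m); last first.
  rewrite -(local_unit noethR localR) => Ur.
  by exists e, r^-1; rewrite xE mulKr.
case/eqP: (c0); apply: completeR.1 => k.
have [|s sE] := cy (e + (k + e0))%N.
  by rewrite addnA leq_addl.
have -> : c = s * r ^+ (p ^ (k + e0)).
  have yq0 : y ^+ (p ^ (e + (k + e0))) != 0 by exact: expf_neq0.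
  by apply: (mulIf yq0); rewrite sE (multiple_raise (k + e0) xE) mulrA.
case: (is_ideal_exp [set` m] k) => _ _; apply.
apply: (@ideal_exp_le _ _ k (p ^ (k + e0))); last exact: ideal_exprn.
by apply: leq_trans (ltnW (frob_gt charRp _)); exact: leq_addr.
Qed.

(** If instead x^q = r y^q with r in m, then the equation raised to a suitable
    power becomes y^N (1 + t) = 0 with t in m, and y = 0. *)
Lemma frob_multiple_of_integral (x y : R) e n (a : nat -> R) :
  (forall i, (1 <= i <= n)%N -> principal (x ^+ (p ^ e * i)) (a i ^+ (p ^ e))) ->
  y ^+ n + \sum_(1 <= i < n.+1) a i * y ^+ (n - i) = 0 ->
  exists e', principal (x ^+ (p ^ e')) (y ^+ (p ^ e')).
Proof.
move=> ax yE; have [e' [xy|[r xE]]] := frob_comparable x y; first by exists e'.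
have [mr|] := boolP (r \in m); last first.
  rewrite -(local_unit noethR localR) => Ur.
  by exists e', r^-1; rewrite xE mulKr.
suff -> : y = 0.
  by exists 0%N; exists 0; rewrite !expr1 mul0r.
have /choice[b bE] : forall i, exists bi, (1 <= i <= n)%N ->
    a i ^+ (p ^ e) = bi * x ^+ (p ^ e * i).
  by move=> i; have [/ax[bi biE]|_] := boolP (1 <= i <= n)%N; [exists bi|exists 0].
pose t := \sum_(1 <= i < n.+1) b i ^+ (p ^ e') * r ^+ (p ^ e * i).
have mt : t \in m.
  rewrite /t big_nat; apply: rpred_sum => i /andP[i1 _]; apply: idealMr.
  have : (0 < p ^ e * i)%N by rewrite muln_gt0 (frob_gt0 charRp).
  by move=> /prednK <-; rewrite exprSr idealMr.
have : y ^+ (p ^ (e + e') * n) * (1 + t) = 0.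
  move: (congr1 (fun z => z ^+ (p ^ (e + e'))) yE).
  rewrite expr0n gtn_eqF ?(frob_gt0 charRp) // -[false%:R]/(0 : R).
  rewrite (frobD charRp) (frob_sum charRp) mulrDr mulr1 => <-.
  rewrite -exprM mulnC; congr (_ + _); rewrite mulr_sumr !big_nat.
  apply: eq_bigr => i /[dup] /bE biE /andP[i1]; rewrite ltnS => i_n.
  have aE : a i ^+ (p ^ (e + e')) =
      b i ^+ (p ^ e') * (r ^+ (p ^ e * i) * y ^+ (p ^ (e + e') * i)).
    rewrite expnD exprM biE exprMn; congr (_ * _).
    by rewrite -exprM mulnC exprM xE exprMn -!exprM mulnCA mulnA.
  rewrite exprMn aE -exprM [((n - i) * _)%N]mulnC -!mulrA -exprD -mulnDr subnKC //.
  by rewrite mulrC -mulrA [(n * _)%N]mulnC.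
move=> /eqP; rewrite mulf_eq0 expf_eq0 => /orP[/andP[_ /eqP]//|].
by move=> /eqP t0; have := unit_1D mt; rewrite t0 unitr0.
Qed.

End Comparison.

Lemma off_minimal_primes_neq0 (R : idomainType) (c : R) :
  off_minimal_primes c -> c != 0.
Proof.
have [P0 P0P] := exists_zero_prime R.
move=> /(_ P0) Pc; apply: contraNneq (Pc _) => [->|]; first exact/P0P.
by move=> Q _ x /P0P ->; exact: idealr0.
Qed.

Lemma off_minimal_primes1 (R : comNzRingType) : off_minimal_primes (1 : R).
Proof. by move=> P _; rewrite idealr1. Qed.

Lemma frobenius_power_sub_exp (R : comNzRingType) (I : set R) q :
  frobenius_power I q `<=` ideal_exp I q.
Proof.
apply: ideal_gen_min; first exact: is_ideal_exp.
by move=> _ [x Ix <-]; exact: ideal_exprn.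
Qed.

Theorem proposition6p11 (R : idomainType) (p : nat) (m : idealr R)
    (charRp : p \in [pchar R])
    (noethR : noetherian R)
    (localR : local_with m)
    (dimR : krull_dim_is R 1)
    (completeR : adically_complete [set` m])
    (closed_residue : GRing.closed_field_axiom {ideal_quot m})
    (I : set R) (idealI : is_ideal I) :
  integral_closure I = tight_closure p I /\
  tight_closure p I = frobenius_closure p I.
Proof.
have [x Ix [e xP]] := frob_principal charRp noethR localR dimR completeR closed_residue idealI.
(* The ideal I^[q] is generated by x^q for q large. *)
have closureP y : frobenius_closure p I y <->
    exists e', principal (x ^+ (p ^ e')) (y ^+ (p ^ e')).
  split=> [[e' ye']|[e' [r rE]]]; last first.
    exists e'; rewrite rE; case: (is_ideal_gen [set z ^+ (p ^ e') | z in I]) => _ _; apply.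
    by apply: sub_ideal_gen; exists x.
  exists (e' + e)%N.
  have -> : y ^+ (p ^ (e' + e)) = (y ^+ (p ^ e')) ^+ (p ^ e).
    by rewrite -exprM -expnD.
  move: ye'.
  have iJ := is_ideal_frob_preimage charRp e
    (is_ideal_principal (x ^+ (p ^ (e' + e)))).
  apply: (ideal_gen_min iJ).
  move=> _ [z Iz <-]; rewrite /= -exprM -expnD addnC.
  have [r rE] := xP z Iz; exists (r ^+ (p ^ e')); exact: multiple_raise.
have intF : integral_closure I = frobenius_closure p I.
  apply/seteqP; split=> y.
    move=> [n [a [n0 aI yE]]]; apply/closureP.
    apply: (frob_multiple_of_integral charRp noethR localR dimR completeR
              closed_residue (e := e)) yE.
    by move=> i /aI ai; apply: (ideal_exp_frob_multiple charRp xP ai).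
  move=> [e' ye']; have q0 := frob_gt0 charRp e'.
  (* y^q is in I^[q], hence in I^q, and Y^q - y^q is an integral equation. *)
  exists (p ^ e')%N, (fun i => if i == (p ^ e')%N then - y ^+ (p ^ e') else 0); split=> //.
    move=> i _; case: eqP => [->|_]; last by case: (is_ideal_exp I i).
    rewrite -mulN1r; case: (is_ideal_exp I (p ^ e')) => _ _; apply.
    exact: frobenius_power_sub_exp.
  rewrite big_nat_recr //= eqxx subnn mulr1 big_nat big1 ?add0r ?subrr //.
  by move=> i /andP[_ iq]; rewrite ltn_eqF // mul0r.
suff tF : tight_closure p I = frobenius_closure p I by rewrite intF tF.
apply/seteqP; split=> y.
  move=> [c /off_minimal_primes_neq0 c0 [e0 cy]]; apply/closureP.
  apply: (frob_multiple_of_almost charRp noethR localR dimR completeR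
            closed_residue (e0 := e + e0) c0).
  move=> e' ee'; move: (cy e' (leq_trans (leq_addl _ _) ee')).
  apply: ideal_gen_min; first exact: is_ideal_principal.
  move=> _ [z Iz <-]; have [r rE] := xP z Iz; exists (r ^+ (p ^ (e' - e))).
  by rewrite -(subnKC (leq_trans (leq_addr e0 e) ee')) (multiple_raise _ rE) addKn.
move=> [e' ye']; exists 1; first exact: off_minimal_primes1.
(* The multiplier 1 works, as Frobenius carries I^[q] into I^[qp]. *)
exists e' => k ek; rewrite mul1r -(subnKC ek) expnD exprM -expnD.
exact: frobenius_power_frob.
Qed.
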